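(* For every integer $k\geq 3$ there is a finite simple graph $G$ that contains neither $P_2+P_3$ nor $\overline{P_2+P_3}$ as an induced subgraph, such that $\omega(G)=k$ and $\chi(G)=\max\{k+3,\lfloor \tfrac{3}{2}k\rfloor-1\}$.
   Context: $P_\ell$ denotes the chordless path on $\ell$ vertices; $P_2+P_3$ is the disjoint union of a $P_2$ and a $P_3$, and $\overline{P_2+P_3}$ is its complement graph. $\chi(G)$ is the chromatic number and $\omega(G)$ the clique number of $G$. *)

(* Defs.v *)
From mathcomp Require Import all_boot.
Set Implicit Arguments.
Unset Strict Implicit.
Unset Printing Implicit Defensive.

Record sgraph := SGraph {
  vertex :> finType;
  adj : rel vertex;
  adj_sym : symmetric adj;
  adj_irrefl : irreflexive adj
}.

Section Path.
Variable n : nat.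

Definition path_adj : rel 'I_n := fun i j => (i.+1 == j) || (j.+1 == i).

Lemma path_adj_sym : symmetric path_adj.
Proof. by move=> i j; rewrite /path_adj orbC. Qed.

Lemma path_adj_irrefl : irreflexive path_adj.
Proof. by move=> i; rewrite /path_adj orbb eqn_leq ltnn. Qed.

Definition path_graph : sgraph := SGraph path_adj_sym path_adj_irrefl.
End Path.

Section DisjointUnion.
Variables G H : sgraph.

Definition union_adj : rel (G + H)%type := fun u v =>
  match u, v with
  | inl x, inl y => adj x y
  | inr x, inr y => adj x y
  | _, _ => false
  end.

Lemma union_adj_sym : symmetric union_adj.
Proof. by move=> [x|x] [y|y] //=; rewrite adj_sym. Qed.

Lemma union_adj_irrefl : irreflexive union_adj.
Proof. by move=> [x|x] /=; rewrite adj_irrefl. Qed.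

Definition disjoint_union : sgraph := SGraph union_adj_sym union_adj_irrefl.
End DisjointUnion.

Section Complement.
Variable G : sgraph.

Definition compl_adj : rel G := fun x y => (x != y) && ~~ adj x y.

Lemma compl_adj_sym : symmetric compl_adj.
Proof. by move=> x y; rewrite /compl_adj eq_sym adj_sym. Qed.

Lemma compl_adj_irrefl : irreflexive compl_adj.
Proof. by move=> x; rewrite /compl_adj eqxx. Qed.

Definition complement : sgraph := SGraph compl_adj_sym compl_adj_irrefl.
End Complement.

Definition contains_induced (G H : sgraph) : Prop :=
  exists2 f : H -> G, injective f & forall x y, adj (f x) (f y) = adj x y.

Definition is_clique (G : sgraph) (A : {set G}) : bool :=
  [forall x in A, forall y in A, (x != y) ==> adj x y].

Definition clique_number (G : sgraph) : nat :=
  \max_(A : {set G} | is_clique A) #|A|.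

Definition colorable (G : sgraph) (k : nat) : bool :=
  [exists f : {ffun G -> 'I_k}, forall x, forall y, adj x y ==> (f x != f y)].

Lemma colorable_ex (G : sgraph) : exists k, colorable G k.
Proof.
exists #|G|; apply/existsP; exists [ffun x => enum_rank x].
apply/forallP=> x; apply/forallP=> y; apply/implyP=> xy; rewrite !ffunE.
by apply: contraL xy => /eqP/enum_rank_inj->; rewrite adj_irrefl.
Qed.

Definition chromatic_number (G : sgraph) : nat := ex_minn (colorable_ex G).

(* Main.v *)
Require Import Defs.
From mathcomp Require Import all_boot.
Set Implicit Arguments.
Unset Strict Implicit.
Unset Printing Implicit Defensive.

(** Adding a universal vertex preserves freeness and increases both the clique
    number and the chromatic number by one, so the value k + 3 only has to be
    reached for k = 3. There the collinearity graph of the generalized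
    quadrangle GQ(2,4), i.e. the complement of the Schlaefli graph, works. An
    edge lies on a unique line {p, q, r}, which excludes the complement of
    P_2 + P_3 and cliques of size 4, and every point not collinear with p or q
    is collinear with r, so a P_3 anticomplete to the edge pq would lie in the
    neighborhood of r, a disjoint union of edges. That five colors do not
    suffice is established by an exhaustive search.

    The value floor(3k/2) - 1 is reached by the complement of a triangle-free
    graph on 3(k-1) vertices that has independence number k and a matching
    missing at most one vertex: the color classes of the complement are
    vertices and edges of that graph. *)

Local Notation P2_P3 := (disjoint_union (path_graph 2) (path_graph 3)).

(** * Cliques, colorings and induced subgraphs *)

Lemma cliqueP (G : sgraph) (A : {set G}) :
  reflect {in A &, forall x y, x != y -> adj x y} (is_clique A).
Proof.
apply: (iffP forall_inP) => [cA x y xA yA xy | cA x xA].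
  by have /forall_inP/(_ y yA)/implyP := cA x xA; apply.
by apply/forall_inP => y yA; apply/implyP; apply: cA.
Qed.

Lemma clique_number_eq (G : sgraph) (A : {set G}) :
    is_clique A -> (forall B : {set G}, is_clique B -> #|B| <= #|A|) ->
  clique_number G = #|A|.
Proof.
move=> cA maxA; apply/eqP; rewrite eqn_leq; apply/andP; split.
  by apply/bigmax_leqP.
exact: leq_bigmax_cond cA.
Qed.

Lemma clique_number_max (G : sgraph) :
  exists2 A : {set G}, is_clique A
    & clique_number G = #|A| /\ forall B : {set G}, is_clique B -> #|B| <= #|A|.
Proof.
have c0 : is_clique (set0 : {set G}).
  by apply/cliqueP => x y; rewrite inE.
have [|A cA EA] := @eq_bigmax_cond _ (@is_clique G) (fun A => #|A|).
  by apply/card_gt0P; exists set0.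
exists A => //; split=> // B cB; rewrite -EA.
exact: leq_bigmax_cond cB.
Qed.

Lemma colorableP (G : sgraph) k :
  reflect (exists f : G -> 'I_k, forall x y, adj x y -> f x != f y)
          (colorable G k).
Proof.
apply: (iffP existsP) => [[f fP] | [f fP]].
  by exists f => x y xy; move/forallP/(_ x)/forallP/(_ y)/implyP: fP; apply.
exists [ffun x => f x]; apply/forallP => x; apply/forallP => y.
by apply/implyP; rewrite !ffunE; apply: fP.
Qed.

Lemma colorable_leq (G : sgraph) m n :
  m <= n -> colorable G m -> colorable G n.
Proof.
move=> le_mn /colorableP[f fP]; apply/colorableP.
exists (fun x => widen_ord le_mn (f x)) => x y /fP.
by rewrite -!val_eqE.
Qed.

Lemma chromatic_number_eq (G : sgraph) n :
  colorable G n -> (forall m, colorable G m -> n <= m) ->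
  chromatic_number G = n.
Proof.
rewrite /chromatic_number => cn minn; case: ex_minnP => m cm minm.
by apply/eqP; rewrite eqn_leq minm ?minn.
Qed.

Lemma induced_P2_P3 (G : sgraph) :
    contains_induced G P2_P3 ->
  exists p q x y z : G,
    [/\ [/\ adj p q, adj x y & adj y z], x != z, ~~ adj x z,
        [/\ ~~ adj p x, ~~ adj p y & ~~ adj p z]
      & [/\ ~~ adj q x, ~~ adj q y & ~~ adj q z]].
Proof.
pose o2 i : vertex P2_P3 := inl (inord i : 'I_2).
pose o3 i : vertex P2_P3 := inr (inord i : 'I_3).
case=> f f_inj fE; exists (f (o2 0)), (f (o2 1)), (f (o3 0)), (f (o3 1)), (f (o3 2)).
rewrite !fE /= /path_adj !inordK //; split=> //.
by apply: contraTneq isT => /f_inj[] /(congr1 val) /=; rewrite !inordK.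
Qed.

(** Here [a], [c] are the ends of the P_3 and [u], [v] the P_2; dropping the middle vertex leaves
    two triangles on the edge [ac]. *)
Lemma induced_compl_P2_P3 (G : sgraph) :
    contains_induced G (complement P2_P3) ->
  exists u v a c : G,
    [/\ u != v, adj a c, adj a u /\ adj c u & adj a v /\ adj c v].
Proof.
pose o2 i : vertex P2_P3 := inl (inord i : 'I_2).
pose o3 i : vertex P2_P3 := inr (inord i : 'I_3).
case=> f f_inj fE; exists (f (o2 0)), (f (o2 1)), (f (o3 0)), (f (o3 2)).
rewrite !fE /= /compl_adj /= /path_adj !inordK // !andbT; split=> //.
  by apply: contraTneq isT => /f_inj[] /(congr1 val) /=; rewrite !inordK.
by apply: contraTneq isT => -[] /(congr1 val) /=; rewrite !inordK.
Qed.

Lemma induced_in_complement (G H : sgraph) :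
  contains_induced (complement G) H -> contains_induced G (complement H).
Proof.
case=> f f_inj fE; exists f => // x y.
rewrite /= /compl_adj; rewrite -fE /= /compl_adj (inj_eq f_inj).
by case: eqP => [->|_] /=; rewrite ?adj_irrefl ?negbK.
Qed.

Lemma induced_complement (G H : sgraph) :
  contains_induced (complement G) (complement H) -> contains_induced G H.
Proof.
case=> f f_inj fE; exists f => // x y.
case: (eqVneq x y) => [->|xy]; first by rewrite !adj_irrefl.
have := fE x y; rewrite /= /compl_adj (inj_eq f_inj) xy /=.
by move/negb_inj.
Qed.

(** * Adding a universal vertex *)

Section Cone.
Variable G : sgraph.

Definition cone_adj : rel (option G) := fun u v =>
  match u, v with
  | Some x, Some y => adj x y
  | None, None => false
  | _, _ => true
  end.

Lemma cone_adj_sym : symmetric cone_adj.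
Proof. by move=> [x|] [y|] //=; rewrite adj_sym. Qed.

Lemma cone_adj_irrefl : irreflexive cone_adj.
Proof. by move=> [x|] //=; rewrite adj_irrefl. Qed.

Definition cone : sgraph := SGraph cone_adj_sym cone_adj_irrefl.

(** Only a universal vertex of [H] can be mapped to the apex. *)
Lemma induced_cone (H : sgraph) :
    (forall x : H, exists2 y, x != y & ~~ adj x y) ->
  contains_induced cone H -> contains_induced G H.
Proof.
move=> non_univ [f f_inj fE].
have [|g gE] := @fin_all_exists H (fun=> G) (fun x a => f x = Some a).
  move=> x; case fx: (f x) => [a|]; first by exists a.
  have [y xy] := non_univ x; rewrite -fE fx /=.
  by case fy: (f y) => //; case/eqP: xy; apply: f_inj; rewrite fx fy.
exists g => [x y xy | x y]; first by apply: f_inj; rewrite !gE xy.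
by rewrite -fE !gE.
Qed.

Lemma clique_number_cone : clique_number cone = (clique_number G).+1.
Proof.
have [A cA [-> maxA]] := clique_number_max G.
have EA : #|None |: [set Some x | x in A]| = #|A|.+1.
  rewrite cardsU1 (card_imset _ (@Some_inj _)); case: imsetP => [[]|] //.
rewrite -EA; apply: clique_number_eq => [|B cB].
  apply/cliqueP => x y /setU1P[->|/imsetP[a aA ->]] /setU1P[->|/imsetP[b bA ->]] //.
  by move=> ab; apply: (cliqueP _ cA).
rewrite {}EA; pose B' := [set x | Some x \in B].
have cB' : is_clique B'.
  apply/cliqueP => x y; rewrite !inE => xB yB xy.
  exact: (cliqueP _ cB (Some x) (Some y)).
rewrite (leq_trans _ (_ : #|B'|.+1 <= _)) ?ltnS ?maxA //.
have /subset_leq_card : B \subset None |: [set Some x | x in B'].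
  apply/subsetP => -[x xB|]; last by rewrite setU11.
  by apply/setU1P; right; apply: imset_f; rewrite inE.
move/leq_trans; apply; rewrite cardsU1 (card_imset _ (@Some_inj _)).
by case: (_ \notin _).
Qed.

Lemma colorable_cone k : colorable cone k.+1 = colorable G k.
Proof.
apply/colorableP/colorableP => [[f fP] | [f fP]].
  have [|g gE] := @fin_all_exists G (fun=> 'I_k)
      (fun x j => f (Some x) = lift (f None) j).
    by move=> x; have /unlift_some[j -> _] := fP None (Some x) isT; exists j.
  exists g => x y /(fP (Some x) (Some y)); rewrite !gE.
  by apply: contraNneq => ->.
exists (fun u => if u is Some x then lift ord_max (f x) else ord_max).
move=> [x|] [y|] //= => [/fP|_|_]; rewrite ?neq_lift //.
  by rewrite (inj_eq lift_inj).
by rewrite eq_sym neq_lift.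
Qed.

Lemma chromatic_number_cone : chromatic_number cone = (chromatic_number G).+1.
Proof.
rewrite {2}/chromatic_number; case: ex_minnP => n cn minn.
apply: chromatic_number_eq; first by rewrite colorable_cone.
case=> [/colorableP[f _]|m]; first by case: (f None).
by rewrite colorable_cone; apply: minn.
Qed.

End Cone.

(** * A complete search for proper colorings *)

Section ColoringSearch.
Variables (T : eqType) (e : rel T) (K : nat).

Implicit Type s : seq (T * seq nat).

(** Branching on a shortest list only keeps the search small; completeness uses membership alone. *)
Definition tightest x s :=
  foldl (fun b y => if size y.2 < size b.2 then y else b) x s.

Lemma mem_tightest x s : tightest x s \in x :: s.
Proof.
elim: s x => [|y s IHs] x; first exact: mem_head.
rewrite -[tightest _ _]/(tightest (if size y.2 < size x.2 then y else x) s).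
by case: ifP => _; [have := IHs y | have := IHs x];
  rewrite !inE => /orP[] ->; rewrite ?orbT.
Qed.

Definition assign v c s :=
  [seq (x.1, if e v x.1 then filter (predC1 c) x.2 else x.2) | x <- s & x.1 != v].

(* Each pending vertex comes with the list of its allowed colors. The colors
   from [m] on have not been used yet, hence are interchangeable, and only
   [m] is tried among them. Exhausted fuel counts as success. *)
Fixpoint search n m s :=
  if (n, s) is (n'.+1, x :: s') then
    let: (v, d) := tightest x s' in
    has (fun c => search n' (maxn m c.+1) (assign v c s)) [seq c <- d | c <= m]
  else true.

Definition extends (f : T -> nat) s :=
  [/\ {in s &, forall x y, e x.1 y.1 -> f x.1 != f y.1},
      {in s, forall x, f x.1 \in x.2} & {in s, forall x, f x.1 < K}].

Lemma search_complete n m s f :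
    {in s, forall x c, m <= c < K -> c \in x.2} -> extends f s -> search n m s.
Proof.
elim: n m s f => [|n IHn] m [|x s'] f //= free [fe fd fK].
have := mem_tightest x s'; case: (tightest x s') => v d.
set s := x :: s' in free fe fd fK * => vs.
(* Colors from [m] on are allowed at every pending vertex, so exchanging [f v] with [m] gives
   another extension, in which [v] has color [m]. *)
wlog le_fm : f fe fd fK / f v <= m => [wl|].
  case: (leqP (f v) m) => [|lt_mf]; first exact: wl.
  have fvK := fK _ vs; have mK := ltn_trans lt_mf fvK; rewrite /= in fvK mK.
  pose swap c := if c == m then f v else if c == f v then m else c.
  have swapK : involutive swap.
    move=> c; rewrite /swap; case: (eqVneq c m) => [->|cm].
      by rewrite eqxx; case: eqVneq.
    by case: (eqVneq c (f v)) => [->|cv]; rewrite ?eqxx // (negPf cm) (negPf cv).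
  apply: (wl (swap \o f)) => [y z ys zs | y ys | y ys | ] /=.
  - by rewrite (inj_eq (inv_inj swapK)); apply: fe.
  - by rewrite /swap; do 2?case: ifP => _; rewrite ?fd ?free ?leqnn ?(ltnW lt_mf).
  - by rewrite /swap; do 2?case: ifP => _; rewrite ?fK.
  - by rewrite /swap eqxx; case: ifP => [/eqP->|].
apply/hasP; exists (f v); first by rewrite mem_filter le_fm (fd _ vs).
apply: (IHn _ _ f) => [_ /mapP[y yP ->] c | ].
  move: yP; rewrite mem_filter geq_max -andbA => /andP[yv ys] /and3P[mc fc cK].
  have cy : c \in y.2 by rewrite (free y) ?mc.
  by case: ifP; rewrite //= mem_filter cy /= gtn_eqF.
split=> [_ _ /mapP[y yP ->] /mapP[z zP ->] | _ /mapP[y yP ->] | _ /mapP[y yP ->]] /=;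
  move: yP; rewrite mem_filter => /andP[yv ys].
- by move: zP; rewrite mem_filter => /andP[_ zs]; apply: fe.
- case: ifP => [vy|_]; last exact: fd.
  by rewrite mem_filter fd //= andbT eq_sym; apply: (fe (v, d)).
- exact: fK.
Qed.

End ColoringSearch.

(** * The generalized quadrangle GQ(2,4) *)

(* The collinearity graph is the Cayley graph of the Heisenberg group F_3^3,
   with product (x,y,z)(x',y',z') = (x+x', y+y', z+z'+xy'-x'y), for the
   nontrivial elements of the form (x,y,0) or (0,0,z). The point (x,y,z) is
   encoded as x + 3 y + 9 z. *)
Definition gq_table : seq (seq bool) := Eval vm_compute in
  let x p := p %% 3 in let y p := p %/ 3 %% 3 in let z p := p %/ 9 in
  [seq [seq (p != q) && ((p %% 9 == q %% 9)
              || (z p + x p * y q == z q + x q * y p %[mod 3]))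
       | q <- iota 0 27] | p <- iota 0 27].

Definition collinear p q := nth false (nth [::] gq_table p) q.

Definition gq_check :=
  all (fun p => ~~ collinear p p &&
    all (fun q => (collinear p q == collinear q p) && (~~ collinear p q ||
      if [seq r <- iota 0 27 | collinear p r & collinear q r] is [:: r] then
        all (fun x => [|| collinear p x, collinear q x | collinear r x]) (iota 0 27)
      else false)) (iota 0 27)) (iota 0 27).

Lemma gq_checkT : gq_check. Proof. by vm_compute. Qed.

(** As exhausted fuel yields [true], the value [false] is a genuine refutation. *)
Lemma gq_search_fails :
  search collinear 27 0 [seq (v, iota 0 5) | v <- iota 0 27] = false.
Proof. by vm_compute. Qed.

Definition gq_colors := [:: 0; 1; 2; 1; 1; 1; 2; 2; 2; 1; 0; 3; 0; 0; 0;
  3; 3; 3; 2; 4; 1; 4; 4; 4; 5; 5; 5].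

Lemma gq_colors_proper :
  all (fun p => all (fun q => ~~ collinear p q ||
    (nth 0 gq_colors p != nth 0 gq_colors q)) (iota 0 27)) (iota 0 27).
Proof. by vm_compute. Qed.

(* Otherwise unification unfolds the table. *)
Opaque collinear.

Lemma gq_sym : symmetric (fun p q : 'I_27 => collinear p q).
Proof.
move=> p q; have /allP/(_ p) := gq_checkT; rewrite mem_iota ltn_ord => /(_ isT).
by case/andP=> _ /allP/(_ q); rewrite mem_iota ltn_ord => /(_ isT)/andP[/eqP].
Qed.

Lemma gq_irrefl : irreflexive (fun p q : 'I_27 => collinear p q).
Proof.
move=> p; have /allP/(_ p) := gq_checkT; rewrite mem_iota ltn_ord => /(_ isT).
by case/andP=> /negbTE.
Qed.

Definition gq : sgraph := SGraph gq_sym gq_irrefl.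

Lemma gq_line (p q : gq) : adj p q -> exists r : gq,
  [/\ adj p r /\ adj q r, forall x, adj p x -> adj q x -> x = r
    & forall x, ~~ adj p x -> ~~ adj q x -> adj r x].
Proof.
move=> /= pq; have /allP/(_ p) := gq_checkT; rewrite mem_iota ltn_ord => /(_ isT).
case/andP=> _ /allP/(_ q); rewrite mem_iota ltn_ord pq => /(_ isT)/andP[_].
set s := filter _ _; case/orP=> //; case Es: s => [|r [|]] //.
have mem_s x : (x \in s) = [&& collinear p x, collinear q x & x < 27].
  by rewrite mem_filter mem_iota -andbA.
have := mem_s r; rewrite Es mem_head => /esym/and3P[pr qr ltr] /allP col.
exists (Ordinal ltr); split=> // [x px qx | x /negPf px /negPf qx].
  apply: val_inj; apply/eqP; rewrite /= -[_ == _]/(val x == r) -mem_seq1 -Es mem_s.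
  by rewrite px qx ltn_ord.
have := col x; rewrite mem_iota ltn_ord => /(_ isT).
by rewrite px qx.
Qed.

Lemma gq_free : ~ contains_induced gq P2_P3.
Proof.
case/induced_P2_P3=> [p [q [x [y [z [[pq xy yz] xz _ [px py pz] [qx qy qz]]]]]]].
have [r [_ _ col]] := gq_line pq.
(* [w] is the third point of the line [ry]; [x] and [z] are collinear with both [r] and [y], so both
   equal [w]. *)
have [w [_ uniqw _]] := gq_line (col y py qy).
case/eqP: xz; rewrite (uniqw z (col z pz qz) yz); apply: uniqw (col x px qx) _.
by rewrite adj_sym.
Qed.

Lemma gq_compl_free : ~ contains_induced gq (complement P2_P3).
Proof.
case/induced_compl_P2_P3=> [u [v [a [c [uv ac [au cu] [av cv]]]]]].
have [r [_ uniqr _]] := gq_line ac.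
by case/eqP: uv; rewrite (uniqr u au cu) (uniqr v av cv).
Qed.

Lemma clique_number_gq : clique_number gq = 3.
Proof.
(* The codes 0 and 9 stand for (0,0,0) and (0,0,1). *)
have pq : adj (inord 0 : gq) (inord 9) by rewrite /= !inordK.
have [r [[pr qr] _ _]] := gq_line pq.
pose A : {set gq} := [set inord 0; inord 9; r].
have neq (x y : gq) : adj x y -> x != y.
  by apply: contraTneq => ->; rewrite adj_irrefl.
have EA : #|A| = 3.
  by rewrite /A setUC cardsU1 cards2 !inE negb_or !(eq_sym r) !neq.
rewrite -EA; apply: clique_number_eq => [|B cB]; last rewrite {}EA.
  apply/cliqueP => x y; rewrite !inE -!orbA.
  by case/or3P=> /eqP-> /or3P[] /eqP->; rewrite ?eqxx // adj_sym.
have [le1|/card_gt1P[a [b [aB bB ab]]]] := leqP #|B| 1.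
  exact: leq_trans le1 _.
have [t [_ uniqt _]] := gq_line (cliqueP _ cB _ _ aB bB ab).
have /subset_leq_card/leq_trans : B \subset [set a; b; t].
  apply/subsetP => x xB; rewrite !inE.
  have [//|xa] := eqVneq x a; have [//|xb] := eqVneq x b.
  by rewrite (uniqt x) ?eqxx ?(cliqueP _ cB) // eq_sym.
apply; rewrite setUC cardsU1 cards2.
by case: (_ \notin _); case: (_ != _).
Qed.


Lemma gq_not_5_colorable : ~~ colorable gq 5.
Proof.
apply/colorableP => -[f fP].
suff: search collinear 27 0 [seq (v, iota 0 5) | v <- iota 0 27].
  by rewrite gq_search_fails.
apply: (@search_complete _ _ 5 _ _ _ (fun p => f (inord p))).
  by move=> _ /mapP[p _ ->] c; rewrite mem_iota.
split=> [_ _ /mapP[p pP ->] /mapP[q qP ->] | _ /mapP[p _ ->] | _ /mapP[p _ ->]].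
- rewrite !mem_iota in pP qP => pq.
  by apply: (fP (inord p) (inord q)); rewrite /= !inordK.
- by rewrite -[_.2]/(iota 0 5) mem_iota ltn_ord.
- exact: ltn_ord.
Qed.

Lemma gq_6_colorable : colorable gq 6.
Proof.
have lt6 (p : gq) : nth 0 gq_colors p < 6.
  have /allP lt6 : all (fun c => c < 6) gq_colors by [].
  by apply/lt6/mem_nth; apply: ltn_ord.
apply/colorableP; exists (fun p => Ordinal (lt6 p)) => p q /= pq.
have /allP/(_ p) := gq_colors_proper.
rewrite mem_iota ltn_ord => /(_ isT)/allP/(_ q).
by rewrite mem_iota ltn_ord pq => /(_ isT).
Qed.

Lemma chromatic_number_gq : chromatic_number gq = 6.
Proof.
apply: chromatic_number_eq gq_6_colorable _ => m cm.
by rewrite ltnNge; apply: contra gq_not_5_colorable => /colorable_leq; apply.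
Qed.

Lemma iterated_cone_gq k : 3 <= k ->
  exists G : sgraph,
    [/\ ~ contains_induced G P2_P3, ~ contains_induced G (complement P2_P3),
        clique_number G = k & chromatic_number G = k + 3].
Proof.
elim: k => // k IHk; rewrite leq_eqVlt => /predU1P[<-|/IHk[G [G1 G2 <- chiG]]].
  by exists gq; split; [exact: gq_free | exact: gq_compl_free
    | exact: clique_number_gq | exact: chromatic_number_gq].
exists (cone G); split; last 2 first.
- exact: clique_number_cone.
- by rewrite chromatic_number_cone chiG.
- move/induced_cone => F; apply/G1/F => -[x|x]; first by exists (inr ord0).
  by exists (inl ord0).
move/induced_cone => F; apply/G2/F => x.
(* The complement has no universal vertex because P_2 + P_3 has no isolated one. *)
have [y xy] : exists y : P2_P3, adj (x : P2_P3) y.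
  case: x => [[[|[|//]] i]|[[|[|[|//]]] i]].
  - by exists (inl (inord 1)); rewrite /= /path_adj inordK.
  - by exists (inl (inord 0)); rewrite /= /path_adj inordK.
  - by exists (inr (inord 1)); rewrite /= /path_adj inordK.
  - by exists (inr (inord 0)); rewrite /= /path_adj inordK.
  - by exists (inr (inord 1)); rewrite /= /path_adj inordK.
exists y; last by apply/nandP; right; rewrite xy.
by apply: contraTneq xy => ->; rewrite adj_irrefl.
Qed.

(** * Complements of triangle-free graphs *)

(** A color class of the complement is a clique of [H], hence has at most two vertices. *)
Lemma card_triangle_free (H : sgraph) n :
    (forall x y z : H, adj x y -> adj y z -> adj x z -> False) ->
  colorable (complement H) n -> #|H| <= 2 * n.
Proof.
move=> noK3 /colorableP[f fP].
have same (x y : H) c : f x = c -> f y = c -> x != y -> adj x y.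
  move=> fx fy xy; apply: contraT => nxy.
  have /fP : @adj (complement H) x y by rewrite /= /compl_adj xy.
  by rewrite fx fy eqxx.
have fibre c : #|[set x | f x == c]| <= 2.
  rewrite leqNgt; apply/negP => /card_gt2P[x [y [z [[]]]]].
  rewrite !inE => /eqP fx /eqP fy /eqP fz [xy yz zx].
  by apply: (noK3 x y z); apply: (same _ _ c); rewrite // eq_sym.
rewrite -sum1_card (partition_big f xpredT) // mulnC.
rewrite -[X in _ <= X * _](card_ord n) -sum_nat_const.
by apply: leq_sum => c _; rewrite sum1dep_card; apply: fibre.
Qed.

Section TriangleFree.
Variable m : nat.

(* Three classes a, b, c of [m] vertices, tagged [Some true], [Some false] and
   [None]: a_i and b_j are adjacent iff i <> j, and c_i is adjacent exactly
   to a_i and b_i. *)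
Definition abc_adj : rel (option bool * 'I_m)%type := fun u v =>
  (u.1 != v.1) && ((u.2 == v.2) == ((u.1 == None) || (v.1 == None))).

Lemma abc_sym : symmetric abc_adj.
Proof.
by move=> u v; rewrite /abc_adj eq_sym [u.2 == _]eq_sym [(u.1 == None) || _]orbC.
Qed.

Lemma abc_irrefl : irreflexive abc_adj.
Proof. by move=> u; rewrite /abc_adj eqxx. Qed.

Definition abc : sgraph := SGraph abc_sym abc_irrefl.

Lemma abc_triangle_free (x y z : abc) : adj x y -> adj y z -> adj x z -> False.
Proof.
case: x y z => [[[]|] i] [[[]|] j] [[[]|] l] //=;
  rewrite /abc_adj /= ?eqb_id ?eqbF_neg;
  by move=> /eqP ? /eqP ? /eqP ?; congruence.
Qed.

Lemma abc_free : ~ contains_induced abc P2_P3.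
Proof.
case/induced_P2_P3=> [p [q [x [y [z [[+ + +] + + [+ + +] [+ + +]]]]]]].
(* Once the five tags are fixed, each hypothesis is trivial or an equality or disequality of
   indices, and these are contradictory in every case. *)
case: p q x y z => [[[]|] p] [[[]|] q] [[[]|] x] [[[]|] y] [[[]|] z] //=;
  rewrite /abc_adj /= ?xpair_eqE /= ?eqb_id ?eqbF_neg ?negbK //;
  repeat (move=> /eqP ? || move=> _); congruence.
Qed.


Lemma abc_complement_colorable : colorable (complement abc) (uphalf (3 * m)).
Proof.
(* The color classes are the edges a_2i b_2i+1, b_2i c_2i and a_2i+1 c_2i+1. *)
pose r (s : option bool) (b : bool) : nat :=
  match s with
  | Some true => if b then 2 else 0
  | Some false => if b then 0 else 1
  | None => if b then 2 else 1
  end.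
have r_lt3 s b : r s b < 3 by case: s b => [[]|] [].
pose col (u : abc) := u.2./2 * 3 + r u.1 (odd u.2).
have col_lt u : col u < uphalf (3 * m).
  (* This reduces to 2r < 3 for even indices, where r is at most 1, and to 2r < 6 for odd ones,
     where r is at most 2. *)
  rewrite gtn_uphalf_double (leq_trans _ (_ : 3 * u.2.+1 <= 3 * m)) //; last first.
    by rewrite leq_mul2l ltn_ord.
  rewrite -[X in _ <= 3 * X.+1]odd_double_half /col.
  rewrite doubleD [3 * _.+1]mulnS mulnDr -!muln2 mulnAC [3 * (_ * 2)]mulnC.
  rewrite addnA [X in _ <= X]addnC -addnS leq_add2l.
  by case: u.1 (odd u.2) => [[]|] [].
apply/colorableP; exists (fun u => Ordinal (col_lt u)) => u v /andP[uv].
apply: contraNneq => /(congr1 val) /=; rewrite /col => Euv.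
have Eh : u.2./2 = v.2./2.
  by move/(congr1 (divn^~ 3)): Euv; rewrite !divnMDl // !divn_small ?addn0.
have Er : r u.1 (odd u.2) = r v.1 (odd v.2).
  by move/(congr1 (modn^~ 3)): Euv; rewrite !modnMDl !modn_small.
have Eo : (u.2 == v.2) = (odd u.2 == odd v.2).
  apply/eqP/eqP => [->//|Eo]; apply: val_inj => /=.
  by rewrite -[LHS]odd_double_half -[RHS]odd_double_half Eh Eo.
move: uv Er; rewrite /abc_adj -pair_eqE /= {}Eo.
by case: u.1 (odd u.2) v.1 (odd v.2) => [[]|] [] [[]|] [].
Qed.

Lemma chromatic_number_abc_complement :
  chromatic_number (complement abc) = uphalf (3 * m).
Proof.
apply: chromatic_number_eq abc_complement_colorable _ => n.
move/(card_triangle_free abc_triangle_free).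
by rewrite card_prod card_option card_bool card_ord leq_uphalf_double mul2n.
Qed.

(** [B] is independent in [abc], so two of its vertices share an index only as a pair a_i, b_i.
    There is at most one such pair, since a_i and b_j are adjacent for distinct i, j. Removing one
    vertex thus makes the index injective. *)
Lemma abc_clique_le (B : {set complement abc}) : is_clique B -> #|B| <= m.+1.
Proof.
move/cliqueP=> cB.
have indep u v : u \in B -> v \in B -> ~~ abc_adj u v.
  move=> uB vB; have [->|uv] := eqVneq u v; first by rewrite abc_irrefl.
  by case/andP: (cB _ _ uB vB uv).
have snd_inj u v : u \in B -> v \in B -> u.2 = v.2 -> u = v \/
    [/\ (Some true, u.2) \in B, (Some false, u.2) \in B
      & u = (Some true, u.2) \/ v = (Some true, u.2)].
  case: u v => [s i] [t j] uB vB /= ij; move: vB (indep _ _ uB vB).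
  rewrite -{}ij /abc_adj /= eqxx.
  case: s t uB => [[]|] [[]|] // uB vB _; try by left.
    by right; split=> //; left.
  by right; split=> //; right.
have [->|[a0 _]] := set_0Vmem B; first by rewrite cards0.
suff [a inja] : exists a, {in B :\ a &, injective snd}.
  rewrite (cardsD1 a) -(card_in_imset inja) -[m in m.+1]card_ord -add1n.
  by apply: leq_add; [case: (_ \in _) | apply: max_card].
have [i /andP[aB bB]|nab] := pickP (fun i => ((Some true, i) \in B)
                                          && ((Some false, i) \in B)).
  exists (Some true, i) => u v /setD1P[ua uB] /setD1P[va vB].
  case/(snd_inj u v uB vB)=> // -[aB' bB'].
  have := indep _ _ aB bB'; rewrite /abc_adj /= eqbF_neg negbK => /eqP <-.
  by case=> /eqP; [rewrite (negPf ua) | rewrite (negPf va)].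
exists a0 => u v /setD1P[_ uB] /setD1P[_ vB].
case/(snd_inj u v uB vB)=> // -[aB bB _].
by have := nab u.2; rewrite aB bB.
Qed.

End TriangleFree.

Lemma clique_number_abc_complement m :
  clique_number (complement (abc m.+1)) = m.+2.
Proof.
(* The independent set a_0, b_0 and all c_i with i nonzero. *)
pose A : {set complement (abc m.+1)} := (Some true, ord0) |:
  [set (if i == ord0 then Some false else None, i) | i : 'I_m.+1].
have EA : #|A| = m.+2.
  rewrite cardsU1 card_imset ?card_ord => [|i j [_ //]].
  by case: imsetP => // -[i _ []]; case: ifP.
rewrite -EA; apply: clique_number_eq => [|B cB]; last first.
  by rewrite EA abc_clique_le.
apply/cliqueP => u v uA vA uv; apply/andP; split=> //; move: uv.
case/setU1P: uA => [->|/imsetP[i _ ->]]; case/setU1P: vA => [->|/imsetP[j _ ->]];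
  rewrite ?eqxx // -pair_eqE /= /abc_adj /=.
- by case: (eqVneq j ord0).
- by case: (eqVneq i ord0).
case: (eqVneq i ord0) => [->|i0]; case: (eqVneq j ord0) => // ->.
by rewrite (negPf i0).
Qed.

(** * Choice of the construction attaining the maximum *)

Theorem theorem1p2 (k : nat) (hk : 3 <= k) :
  exists G : sgraph,
    [/\ ~ contains_induced G (disjoint_union (path_graph 2) (path_graph 3)),
        ~ contains_induced G
            (complement (disjoint_union (path_graph 2) (path_graph 3))),
        clique_number G = k
      & chromatic_number G = maxn (k + 3) ((3 * k) %/ 2 - 1)].
Proof.
case: k hk => [//|[//|m]] hk; rewrite divn2.
(* With k = m + 2, floor(3k/2) - 1 is half of 3(k-1), rounded up. *)
have -> : (3 * m.+2)./2 - 1 = uphalf (3 * m.+1).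
  by rewrite mulnS addnC addn3 /= subn1.
case: (leqP (uphalf (3 * m.+1)) (m.+2 + 3)) => _.
  exact: iterated_cone_gq.
exists (complement (abc m.+1)); split.
(* A P_2 + P_3 in the complement would give a triangle [a], [c], [u] in [abc]. *)
- case/induced_in_complement/induced_compl_P2_P3=> u [_ [a [c [_ ac [au cu] _]]]].
  exact: abc_triangle_free ac cu au.
- by move/induced_complement/abc_free.
- exact: clique_number_abc_complement.
- by rewrite chromatic_number_abc_complement.
Qed.
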